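(* Let $\mathcal{R}$ be a commutative ring with unity and let $\mathcal{A}$ be any of the following $\mathcal{R}$-algebras: (i) $\mathcal{A}=M_n(\mathcal{B})$, where $\mathcal{B}$ is an algebra and $n\geq 2$; (ii) $\mathcal{A}$ is a simple algebra containing a non-trivial idempotent; (iii) $\mathcal{A}$ is an algebra containing an idempotent $e$ such that the (two-sided) ideals generated by $e$ and by $1-e$, respectively, are both equal to $\mathcal{A}$. Then for any right $\mathcal{A}$-module $\mathcal{X}$, every local left multiplier $\psi:\mathcal{A}\to\mathcal{X}$ is a left multiplier. In particular, $\mathcal{A}$ is a SLIP algebra.
   Context: All algebras are associative $\mathcal{R}$-algebras with unity $1$ and all modules are unital; modules over an $\mathcal{R}$-algebra are $\mathcal{R}$-modules in the compatible way. An idempotent $e$ is non-trivial if $e\neq 0,1$. $M_n(\mathcal{B})$ is the algebra of $n\times n$ matrices over $\mathcal{B}$. For an algebra $\mathcal{A}$ and a right $\mathcal{A}$-module $\mathcal{X}$, an $\mathcal{R}$-linear map $\psi:\mathcal{A}\to\mathcal{X}$ is a left multiplier if $\psi(a)=\psi(1)a$ for all $a\in\mathcal{A}$; it is a local left multiplier if for each $a\in\mathcal{A}$ there exists $x_a\in\mathcal{X}$ with $\psi(a)=x_a a$. An $\mathcal{R}$-linear map $\psi:\mathcal{A}\to\mathcal{A}$ is LIP (left-ideal-preserving) if $\psi(\mathcal{J})\subseteq\mathcal{J}$ for every left ideal $\mathcal{J}$ of $\mathcal{A}$ (equivalently, $\psi$ is a local left multiplier from $\mathcal{A}$ to $\mathcal{A}$).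 The algebra $\mathcal{A}$ is SLIP if every LIP map on $\mathcal{A}$ is a left multiplier. *)

(* Defs.v *)
From HB Require Import structures.
From mathcomp Require Import all_boot all_algebra.

Set Implicit Arguments.
Unset Strict Implicit.
Unset Printing Implicit Defensive.

Import GRing.Theory.
Local Open Scope ring_scope.

(* Unital associative R-algebras, the zero algebra included. The library's    *)
(* algType imposes 1 != 0, and its hierarchy has no join of PzRing and        *)
(* Lmodule below it, so the scalar action is a separate operation rather than *)
(* *:%R. This also frees 'M[B]_n from its library module structure over B.    *)
HB.mixin Record isPzAlgebra (R : comPzRingType) A of GRing.PzRing A := {
  algscale : R -> A -> A;
  algscaleA : forall r s a, algscale r (algscale s a) = algscale (r * s) a;
  algscale1 : left_id 1 algscale;
  algscaleDr : right_distributive algscale +%R;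
  algscaleDl : forall a, {morph algscale^~ a : r s / r + s};
  algscaleAl : forall r a b, algscale r (a * b) = algscale r a * b;
  algscaleAr : forall r a b, algscale r (a * b) = a * algscale r b
}.

#[short(type="pzAlgType")]
HB.structure Definition PzAlgebra (R : comPzRingType) :=
  {A of isPzAlgebra R A & GRing.PzRing A}.

(* Every algType is covered; the alias keeps the scalar action of an abstract *)
(* algType from being inferred through two competing structures.              *)
Definition alg_as_pzalg (R : comPzRingType) (A : algType R) : Type := A.

HB.instance Definition _ (R : comPzRingType) (A : algType R) :=
  GRing.PzRing.copy (alg_as_pzalg A) A.

HB.instance Definition _ (R : comPzRingType) (A : algType R) :=
  isPzAlgebra.Build R (alg_as_pzalg A) (@scalerA R A) (@scale1r R A)
    (@scalerDr R A) (fun a r s => scalerDl a r s) (@scalerAl R A)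
    (@scalerAr R A).

Section MatrixAlgebra.
Variables (R : comPzRingType) (B : pzAlgType R) (n : nat).
Implicit Types (r s : R) (M N : 'M[B]_n).

Definition mxalgscale r M : 'M[B]_n := map_mx (algscale r) M.

Lemma mxalgscaleA r s M : mxalgscale r (mxalgscale s M) = mxalgscale (r * s) M.
Proof. by apply/matrixP => i j; rewrite !mxE algscaleA. Qed.

Lemma mxalgscale1 : left_id 1 mxalgscale.
Proof. by move=> M; apply/matrixP => i j; rewrite !mxE algscale1. Qed.

Lemma mxalgscaleDr : right_distributive mxalgscale +%R.
Proof. by move=> r M N; apply/matrixP => i j; rewrite !mxE algscaleDr. Qed.

Lemma mxalgscaleDl M : {morph mxalgscale^~ M : r s / r + s}.
Proof. by move=> r s; apply/matrixP => i j; rewrite !mxE algscaleDl. Qed.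

Let algscale0 r : algscale r (0 : B) = 0.
Proof. by apply: (addIr (algscale r 0)); rewrite -algscaleDr !add0r. Qed.

Lemma mxalgscaleAl r M N : mxalgscale r (M * N) = mxalgscale r M * N.
Proof.
apply/matrixP => i j; rewrite !mxE.
rewrite (big_morph (algscale r) (algscaleDr r) (algscale0 r)).
by apply: eq_bigr => k _; rewrite mxE algscaleAl.
Qed.

Lemma mxalgscaleAr r M N : mxalgscale r (M * N) = M * mxalgscale r N.
Proof.
apply/matrixP => i j; rewrite !mxE.
rewrite (big_morph (algscale r) (algscaleDr r) (algscale0 r)).
by apply: eq_bigr => k _; rewrite mxE algscaleAr.
Qed.

HB.instance Definition _ := isPzAlgebra.Build R 'M[B]_n
  mxalgscaleA mxalgscale1 mxalgscaleDr mxalgscaleDl mxalgscaleAl mxalgscaleAr.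

End MatrixAlgebra.

Section Ideals.
Variables (R : comPzRingType) (A : pzAlgType R).
Implicit Types (e : A) (I J : A -> Prop).

(* Stability under scalars is automatic: r a = (r 1) a. *)
Definition left_ideal J :=
  [/\ J 0, forall a b, J a -> J b -> J (a - b) & forall c a, J a -> J (c * a)].

Definition two_sided_ideal I :=
  left_ideal I /\ forall c a, I a -> I (a * c).

Definition ideal_generated_by e : A -> Prop :=
  fun a => forall I, two_sided_ideal I -> I e -> I a.

Definition simple_algebra :=
  (1 : A) <> 0 /\
  forall I, two_sided_ideal I -> (forall a, I a -> a = 0) \/ (forall a, I a).

Definition idempotent_elt e := e * e = e.

Definition nontrivial_idempotent e :=
  [/\ idempotent_elt e, e <> 0 & e <> 1].

End Ideals.

Section Multipliers.
Variables (R : comPzRingType) (A : pzAlgType R).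

(* A right A-module is a left module over the converse ring A^c. *)
Definition ract (X : lmodType A^c) (x : X) (a : A) : X := (a : A^c) *: x.

(* The R-module structure compatible with the right A-module structure:       *)
(* r x = r (x 1) = x (r 1) is forced.                                         *)
Definition rscale (X : lmodType A^c) (r : R) (x : X) : X :=
  ract x (algscale r 1).

Definition R_linear (X : lmodType A^c) (psi : A -> X) :=
  {morph psi : a b / a + b} /\
  forall r a, psi (algscale r a) = rscale r (psi a).

Definition left_multiplier (X : lmodType A^c) (psi : A -> X) :=
  R_linear psi /\ forall a, psi a = ract (psi 1) a.

Definition local_left_multiplier (X : lmodType A^c) (psi : A -> X) :=
  R_linear psi /\ forall a, exists x : X, psi a = ract x a.

(* A as a right module over itself. *)
Definition right_regular : lmodType A^c := (A^c)^o.

Lemma ract_regular (x a : A) : ract (x : right_regular) a = x * a :> A.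
Proof. by []. Qed.

Lemma rscale_regular (r : R) (a : A) :
  rscale r (a : right_regular) = algscale r a :> A.
Proof. by rewrite /rscale ract_regular -algscaleAr mulr1. Qed.

Definition LIP (psi : A -> A) :=
  R_linear (psi : A -> right_regular) /\
  forall J, left_ideal J -> forall a, J a -> J (psi a).

Definition SLIP :=
  forall psi : A -> A, LIP psi -> left_multiplier (psi : A -> right_regular).

End Multipliers.

Inductive listed_algebra (R : comPzRingType) : pzAlgType R -> Prop :=
| ListedMatrix (B : pzAlgType R) (n : nat) of (2 <= n)%N :
    listed_algebra 'M[B]_n
| ListedSimple (A : pzAlgType R) (e : A) of
    simple_algebra A & nontrivial_idempotent e :
    listed_algebra A
| ListedFull (A : pzAlgType R) (e : A) of
    idempotent_elt e & (forall a, ideal_generated_by e a) &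
    (forall a, ideal_generated_by (1 - e) a) :
    listed_algebra A.

(* Main.v *)
Require Import Defs.
From mathcomp Require Import all_boot all_algebra.

(** Let [S] be the set of those [a] with [psi (b a) = psi b . a] for every [b];
    it is a subring of [A], and [psi] is a left multiplier as soon as [S] is
    everything (take [b = 1]).

    The local hypothesis puts every idempotent [e] in [S].  Put [f = 1 - e].
    Since [psi (b e)] lies in [X e] and [psi (b f)] in [X f], multiplying
    [psi b = psi (b e) + psi (b f)] by [e] leaves [psi (b e)], because
    [e e = e] and [f e = 0] ([commutes_idempotent]).

    The element [e + e a f] is again idempotent, so [S] contains the corner
    [e A f], and by symmetry [f A e].  If moreover [f] generates [A] as an
    ideal, then every element of [e A e] is a sum of products of elements of
    [e A f] and [f A e], so [e A e] is in [S] too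
    ([commutes_diagonal_corner]); in the same way [f A f] is in [S] when [e]
    generates [A].  By the Peirce decomposition [S = A]
    ([full_idempotent_left_multiplier]).

    All three families contain an idempotent [e] such that both [e] and [1 - e]
    generate the unit ideal ([listed_algebra_full_idempotent]): in a simple
    algebra every nonzero element does; in a matrix algebra one diagonal matrix
    unit does, and the ideal of [1 - E_00] contains
    [E_11 = E_11 (1 - E_00)].

    Finally a LIP map is a local left multiplier, since [psi a] must stay in the
    left ideal [A a], so the statement about modules applied to [X = A] says
    that [A] is SLIP. *)

Set Implicit Arguments.
Unset Strict Implicit.
Unset Printing Implicit Defensive.

Import GRing.Theory.
Local Open Scope ring_scope.

Section RightAction.
Variables (R : comPzRingType) (A : pzAlgType R) (X : lmodType A^c).
Implicit Types (x y : X) (a b : A).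

Lemma ractM x a b : ract x (a * b) = ract (ract x a) b.
Proof. by rewrite /ract scalerA. Qed.

Lemma ractDr x a b : ract x (a + b) = ract x a + ract x b.
Proof. exact: scalerDl. Qed.

Lemma ractDl x y a : ract (x + y) a = ract x a + ract y a.
Proof. exact: scalerDr. Qed.

Lemma ractBr x a b : ract x (a - b) = ract x a - ract x b.
Proof. exact: scalerBl. Qed.

Lemma ract0r x : ract x 0 = 0.
Proof. exact: scale0r. Qed.

End RightAction.

Section Idempotents.
Variables (R : comPzRingType) (A : pzAlgType R).
Implicit Types (a e : A).

Lemma idempotent_complement e : idempotent_elt e -> idempotent_elt (1 - e).
Proof.
rewrite /idempotent_elt => ee.
by rewrite mulrBl mul1r mulrBr mulr1 ee subrr subr0.
Qed.

Lemma complement_mul_idempotent e : idempotent_elt e -> (1 - e) * e = 0.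
Proof. by rewrite /idempotent_elt => ee; rewrite mulrBl mul1r ee subrr. Qed.

(** [e a (1 - e)] squares to zero, is fixed by [e] on the left and killed by
    [e] on the right. *)
Lemma idempotent_add_corner e a :
  idempotent_elt e -> idempotent_elt (e + e * a * (1 - e)).
Proof.
move=> ee; have := complement_mul_idempotent ee.
rewrite /idempotent_elt; move: (1 - e) => f fe.
rewrite mulrDl !mulrDr -!mulrA fe !mulr0 add0r.
by rewrite (mulrA e e) ee (mulrA f e) fe mul0r !mulr0 addr0.
Qed.

End Idempotents.

Section FixedElements.
Variables (R : comPzRingType) (A : pzAlgType R) (X : lmodType A^c).
Variable psi : A -> X.
Hypothesis psi_local : local_left_multiplier psi.
Implicit Types (a b e : A).

Definition commutes_with_right_mul a := forall b, psi (b * a) = ract (psi b) a.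

Local Notation S := commutes_with_right_mul.

Lemma local_multiplierD : {morph psi : a b / a + b}.
Proof. by case: psi_local => -[]. Qed.

Lemma local_multiplierB : {morph psi : a b / a - b}.
Proof.
by move=> a b; apply: (addIr (psi b)); rewrite -local_multiplierD !subrK.
Qed.

Lemma local_multiplier0 : psi 0 = 0.
Proof. by rewrite -(subrr (0 : A)) local_multiplierB subrr. Qed.

Lemma commutesD a b : S a -> S b -> S (a + b).
Proof. by move=> Sa Sb c; rewrite mulrDr local_multiplierD Sa Sb ractDr. Qed.

Lemma commutesB a b : S a -> S b -> S (a - b).
Proof. by move=> Sa Sb c; rewrite mulrBr local_multiplierB Sa Sb ractBr. Qed.

Lemma commutesM a b : S a -> S b -> S (a * b).
Proof. by move=> Sa Sb c; rewrite mulrA Sb Sa ractM. Qed.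

(** The values [psi (b e)] and [psi (b (1 - e))] have the form [x (b e)] and
    [y (b (1 - e))], so right multiplication by [e] keeps the first and kills
    the second; their sum is [psi b]. *)
Lemma commutes_idempotent e : idempotent_elt e -> S e.
Proof.
move=> ee b; case: psi_local => _ loc.
have {2}-> : b = b * e + b * (1 - e) by rewrite -mulrDr addrC subrK mulr1.
rewrite local_multiplierD ractDl.
have [x ->] := loc (b * e); have [y ->] := loc (b * (1 - e)).
by rewrite -!ractM -!mulrA ee complement_mul_idempotent // mulr0 ract0r addr0.
Qed.

(** Difference of the idempotents [e + e a (1 - e)] and [e]. *)
Lemma commutes_corner e a : idempotent_elt e -> S (e * a * (1 - e)).
Proof.
move=> ee; rewrite -[e * a * _](addKr e) addrC.
apply: commutesB; apply: commutes_idempotent => //.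
exact: idempotent_add_corner.
Qed.

Lemma commutes_opposite_corner e a : idempotent_elt e -> S ((1 - e) * a * e).
Proof.
move=> /idempotent_complement/commutes_corner => /(_ a).
by rewrite opprB addrCA subrr addr0.
Qed.

(** The elements [u] with [e A u A e] contained in [S] form a two-sided ideal.
    It contains [1 - e], because [e c (1 - e) d e] is a product of one element
    from each off-diagonal corner; hence it contains [1]. *)
Lemma commutes_diagonal_corner e a :
  idempotent_elt e -> (forall u, ideal_generated_by (1 - e) u) ->
  S (e * a * e).
Proof.
move=> ee full.
suff /(_ a 1) : forall c d, S (e * c * 1 * d * e) by rewrite !mulr1.
apply: (full 1 (fun u => forall c d, S (e * c * u * d * e))).
- split; first split.
  + by move=> c d b; rewrite !(mulr0, mul0r) local_multiplier0 ract0r.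
  + by move=> u v Iu Iv c d; rewrite mulrBr !mulrBl; apply: commutesB.
  + by move=> w u Iu c d; rewrite mulrA -(mulrA e c w).
  + by move=> w u Iu c d; rewrite mulrA -(mulrA _ w d).
- move=> c d.
  have -> : e * c * (1 - e) * d * e
            = (e * c * (1 - e)) * ((1 - e) * d * e).
    by rewrite !mulrA -[_ * (1 - e) * (1 - e)]mulrA idempotent_complement.
  by apply: commutesM; [apply: commutes_corner | apply: commutes_opposite_corner].
Qed.

(** The four Peirce corners of [a] all lie in [S]. *)
Lemma full_idempotent_left_multiplier e :
  idempotent_elt e -> (forall u, ideal_generated_by e u) ->
  (forall u, ideal_generated_by (1 - e) u) -> left_multiplier psi.
Proof.
move=> ee full_e full_f; split; first by case: psi_local.
move=> a; rewrite -{1}[a]mul1r; set f := 1 - e.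
have ef1 : e + f = 1 by rewrite addrC subrK.
have fK : 1 - f = e by rewrite opprB addrCA subrr addr0.
have -> : a = e * a * e + e * a * f + (f * a * e + f * a * f).
  by rewrite -!mulrDr ef1 !mulr1 -mulrDl ef1 mul1r.
suff : S (e * a * e + e * a * f + (f * a * e + f * a * f)) by apply.
apply: commutesD; apply: commutesD.
- exact: commutes_diagonal_corner.
- exact: commutes_corner.
- exact: commutes_opposite_corner.
- by apply: commutes_diagonal_corner; [apply: idempotent_complement | rewrite fK].
Qed.

End FixedElements.

(** [psi a] lies in the left ideal [A a]. *)
Lemma LIP_local_left_multiplier (R : comPzRingType) (A : pzAlgType R)
    (psi : A -> A) :
  LIP psi -> local_left_multiplier (psi : A -> right_regular A).
Proof.
move=> [lin stable]; split=> // a.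
apply: (stable (fun u => exists x, u = x * a)); last by exists 1; rewrite mul1r.
split.
- by exists 0; rewrite mul0r.
- by move=> _ _ [x ->] [y ->]; exists (x - y); rewrite mulrBl.
- by move=> c _ [x ->]; exists (c * x); rewrite mulrA.
Qed.

Lemma two_sided_idealD (R : comPzRingType) (A : pzAlgType R) (I : A -> Prop) a b :
  two_sided_ideal I -> I a -> I b -> I (a + b).
Proof.
move=> [[I0 IB _] _] Ia Ib; rewrite -[b]opprK; apply: (IB) => //.
by rewrite -sub0r; apply: IB.
Qed.

Lemma simple_ideal_generated (R : comPzRingType) (A : pzAlgType R) (e : A) :
  simple_algebra A -> e <> 0 -> forall a, ideal_generated_by e a.
Proof. by move=> [_ simple] e0 a I /simple[I0 /I0 | ]. Qed.

(** The ideal contains every [E_jj = E_ji E_ii E_ij], hence their sum, the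
    identity matrix. *)
Lemma diagonal_unit_ideal_generated (R : comPzRingType) (B : pzAlgType R)
    (n : nat) (i : 'I_n) (M : 'M[B]_n) :
  ideal_generated_by (delta_mx i i : 'M[B]_n) M.
Proof.
move=> I idI Ii; have [[I0 _ Il] Ir] := idI.
have diag j : I (delta_mx j j).
  rewrite -(mul_delta_mx i) -[X in X *m _](mul_delta_mx i).
  by apply: Ir; apply: Il.
rewrite -[M]mulmx1; apply: Il; rewrite mx1_sum_delta.
by apply: big_ind => // a b; apply: two_sided_idealD.
Qed.

Lemma matrix_full_idempotent (R : comPzRingType) (B : pzAlgType R) (n : nat) :
  (2 <= n)%N ->
  exists e : 'M[B]_n, [/\ idempotent_elt e, forall M, ideal_generated_by e M
                        & forall M, ideal_generated_by (1 - e) M].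
Proof.
move=> n2; pose i : 'I_n := Ordinal (ltnW n2); pose j : 'I_n := Ordinal n2.
exists (delta_mx i i); split.
- exact: mul_delta_mx.
- exact: diagonal_unit_ideal_generated.
- move=> M I idI If; apply: (@diagonal_unit_ideal_generated R B n j M I idI).
  have -> : delta_mx j j = delta_mx j j * (1 - delta_mx i i) :> 'M[B]_n.
    by rewrite mulrBr mulr1 [_ * _]mul_delta_mx_0 // subr0.
  by case: idI => -[_ _ Il] _; apply: Il.
Qed.

Lemma listed_algebra_full_idempotent (R : comPzRingType) (A : pzAlgType R) :
  listed_algebra A ->
  exists e : A, [/\ idempotent_elt e, forall a, ideal_generated_by e a
                  & forall a, ideal_generated_by (1 - e) a].
Proof.
case=> {A} [B n n2 | A e simple [ee e0 e1] | A e ee full_e full_f].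
- exact: matrix_full_idempotent.
- exists e; split=> //; apply: simple_ideal_generated => //.
  by move/subr0_eq => e1'; apply: e1.
- by exists e.
Qed.

Theorem corollary3p3 (R : comPzRingType) (A : pzAlgType R) :
  listed_algebra A ->
  (forall (X : lmodType A^c) (psi : A -> X),
     local_left_multiplier psi -> left_multiplier psi) /\
  SLIP A.
Proof.
move=> /listed_algebra_full_idempotent[e [ee full_e full_f]].
have main (X : lmodType A^c) (psi : A -> X) :
    local_left_multiplier psi -> left_multiplier psi.
  by move=> loc; apply: full_idempotent_left_multiplier full_f.
by split=> // psi /LIP_local_left_multiplier; apply: main.
Qed.
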